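(* Let $\tau$ be the $\mathbb Q$-linear (anti-multiplicative) involution on symbols with $\tau(r)=s$, $\tau(s)=r$, $\tau(\langle i,j\rangle)=\langle j,i\rangle^{-1}$, $\tau(z)=z^{-1}$, $\tau(x_i^{\pm}(k))=x_i^{\mp}(-k)$ for $k\in\mathbb Z$, $\tau(\omega_i(m))=\omega_i'(-m)$ and $\tau(\omega_i'(-m))=\omega_i(m)$ for $m\in\mathbb Z_{\ge 0}$ (where $\omega_i(0)=\omega_i$, $\omega_i'(0)=\omega_i'$). Then for all $i,j\in I$: (i) $\tau(g_{ij}^{\pm}(z))=g_{ij}^{\pm}(z)$, $\; g_{ij}^{\pm}(z)^{-1}=g_{ij}^{\mp}(z)$, and $g_{ij}^{\pm}(z^{-1})=g_{ji}^{\mp}(z)=g_{ji}^{\pm}(z)^{-1}$; (ii) $\tau(\delta(z))=\delta(z)$, $\tau(x_i^{\pm}(z))=x_i^{\mp}(z)$, $\tau(\omega_i(z))=\omega_i'(z)$ and $\tau(\omega_i'(z))=\omega_i(z)$.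
   Context: $\mathbb K$ is an algebraically closed field containing $\mathbb Q(r,s)$, with $r,s$ nonzero complex numbers and $r^2\neq s^2$. $I$ indexes the simple roots of a simple Lie algebra $\mathfrak g$ of type $A_{n-1}$ ($n\ge3$), $D_n$ ($n\ge4$) or $E_6$, with Cartan matrix $(a_{ij})$. Here $I=\{1,\dots,n-1\}$, $\{1,\dots,n\}$, $\{1,\dots,6\}$ respectively. Dynkin edges are $\{i,i+1\}$ for $A_{n-1}$; $\{i,i+1\}$ ($1\le i\le n-2$) and $\{n-2,n\}$ for $D_n$; and $\{1,3\},\{3,4\},\{4,5\},\{5,6\},\{2,4\}$ for $E_6$. The structure constants $\langle i,j\rangle\in\mathbb K^*$ are: $\langle i,i\rangle=rs^{-1}$; if $i<j$ and $a_{ij}=-1$ then $\langle i,j\rangle=r^{-1}$ and $\langle j,i\rangle=s$; in type $D_n$, $\langle n-1,n\rangle=(rs)^{-1}$ and $\langle n,n-1\rangle=rs$; all other $\langle i,j\rangle$ equal $1$. The generating functions are $$g_{ij}^{\pm}(z)=\frac{\langle j,i\rangle^{\pm1}z-(\langle j,i\rangle\langle i,j\rangle^{-1})^{\pm\frac12}}{z-(\langle i,j\rangle\langle j,i\rangle)^{\pm\frac12}},$$ regarded as rational functions of $z$ (and expanded at $z=0$ when a power series is needed). Square roots are computed from fixed square roots $r^{1/2},s^{1/2}$ of $r,s$ (so $(\langle i,i\rangle^2)^{1/2}=\langle i,i\rangle$), and $\tau$ exchanges $r^{1/2}$ and $s^{1/2}$. The other series, in formal symbols $x_i^\pm(k)$,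 $\omega_i(m)$, $\omega_i'(-m)$, are $\delta(z)=\sum_{n\in\mathbb Z}z^n$, $x_i^{\pm}(z)=\sum_{k\in\mathbb Z}x_i^{\pm}(k)z^{-k}$, $\omega_i(z)=\sum_{m\ge0}\omega_i(m)z^{-m}$, $\omega_i'(z)=\sum_{m\ge0}\omega_i'(-m)z^{m}$. The map $\tau$ is applied to series term by term. *)

(* Defs.v *)
From HB Require Import structures.
From mathcomp Require Import all_boot all_order all_algebra fraction finmap.
From mathcomp Require Import mpoly.
From mathcomp Require Import monalg.

Set Implicit Arguments.
Unset Strict Implicit.
Unset Printing Implicit Defensive.

Import GRing.Theory.
Local Open Scope ring_scope.

Notation "x %:F" := (@FracField.tofrac _ x) : ring_scope.

(* [TypeA n] is the type A_{n-1}, i.e. sl_n. *)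
Inductive dynkin := TypeA of nat | TypeD of nat | TypeE6.

Definition admissible (t : dynkin) : bool :=
  match t with
  | TypeA n => (3 <= n)%N
  | TypeD n => (4 <= n)%N
  | TypeE6 => true
  end.

Definition rank (t : dynkin) : nat :=
  match t with TypeA n => n.-1 | TypeD n => n | TypeE6 => 6 end.

(* The index set I = {1, ..., rank}: the ordinal i stands for the label i.+1. *)
Notation node t := 'I_(rank t).

Definition label t (i : node t) : nat := i.+1.

(* Edges {a, b} of the Dynkin diagram, listed with a < b, on labels. *)
Definition edge (t : dynkin) (a b : nat) : bool :=
  match t with
  | TypeA _ => b == a.+1
  | TypeD n => ((b == a.+1) && (a <= n - 2)%N) || ((a == n - 2)%N && (b == n))
  | TypeE6 => (a, b) \in [:: (1, 3); (3, 4); (4, 5); (5, 6); (2, 4)]%N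
  end.

Definition cartan t (i j : node t) : int :=
  if i == j then 2
  else if edge t (label i) (label j) || edge t (label j) (label i) then -1
  else 0.

(* All structure constants are monomials r^p s^q; [brexp i j] is the pair of
   exponents (p, q) of <i,j>. *)
Definition brexp t (i j : node t) : int * int :=
  if i == j then (1, -1)
  else if (label i < label j)%N && (cartan i j == -1) then (-1, 0)
  else if (label j < label i)%N && (cartan j i == -1) then (0, 1)
  else if t is TypeD n then
    if (label i == n.-1) && (label j == n) then (-1, -1)
    else if (label i == n) && (label j == n.-1) then (1, 1)
    else (0, 0)
  else (0, 0).

Definition mono (E : fieldType) (x y : E) (e : int * int) : E :=
  x ^ e.1 * y ^ e.2.

Definition bracket (E : fieldType) (r s : E) t (i j : node t) : E :=
  mono r s (brexp i j).

Definition sgn (eps : bool) : int := if eps then 1 else -1.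

(* g_{ij}^{+-}(w), the sign being + when [eps] is true.  With rh = r^{1/2} and
   sh = s^{1/2}, the square root of the monomial r^p s^q is rh^p sh^q; hence
   (<j,i> <i,j>^{-1})^{1/2} is [mono rh sh (brexp j i - brexp i j)], and
   (<i,j> <j,i>)^{1/2} is [mono rh sh (brexp i j + brexp j i)]. *)
Definition g (E : fieldType) (r s rh sh : E) t (eps : bool) (i j : node t)
    (w : E) : E :=
  (bracket r s j i ^ sgn eps * w
     - mono rh sh (brexp j i - brexp i j) ^ sgn eps)
  / (w - mono rh sh (brexp i j + brexp j i) ^ sgn eps).

(* The scalar symbols r^{1/2}, s^{1/2}, z are independent indeterminates: they
   are the three variables of Q(r^{1/2}, s^{1/2}, z) = Frac Z[r^{1/2}, s^{1/2}, z]. *)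
Definition scal_poly : idomainType := mpoly.mpoly 3 int.
Definition scal : fieldType := {fraction scal_poly}.

Definition scal_var (k : 'I_3) : scal :=
  (mpoly.mpolyX int (mpoly.mnm1 k) : scal_poly)%:F.
Definition rhS : scal := scal_var (inord 0).
Definition shS : scal := scal_var (inord 1).
Definition zS : scal := scal_var (inord 2).
Definition rS : scal := rhS ^+ 2.
Definition sS : scal := shS ^+ 2.

Definition bracketS t (i j : node t) : scal := bracket rS sS i j.
Definition gS t (eps : bool) (i j : node t) : scal :=
  g rS sS rhS shS eps i j zS.

(* [Xgen true i k] is x_i^+(k), [Xgen false i k] is x_i^-(k), [Wgen i m] is
   omega_i(m) and [Wgen' i m] is omega_i'(-m). *)
Inductive gen (t : dynkin) :=
  | Xgen of bool & node t & int
  | Wgen of node t & nat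
  | Wgen' of node t & nat.

Definition gen_code t (x : gen t) :
    (bool * node t * int) + (node t * nat) + (node t * nat) :=
  match x with
  | Xgen eps i k => inl (inl (eps, i, k))
  | Wgen i m => inl (inr (i, m))
  | Wgen' i m => inr (i, m)
  end.

Definition gen_decode t
    (c : (bool * node t * int) + (node t * nat) + (node t * nat)) : gen t :=
  match c with
  | inl (inl (eps, i, k)) => Xgen eps i k
  | inl (inr (i, m)) => Wgen i m
  | inr (i, m) => Wgen' i m
  end.

Lemma gen_codeK t : cancel (@gen_code t) (@gen_decode t).
Proof. by case. Qed.

HB.instance Definition _ t := Choice.copy (gen t) (can_type (@gen_codeK t)).

(* The algebra of symbols: the free associative algebra on the generators, with
   coefficients in Q(r^{1/2}, s^{1/2}, z). *)
Notation symalg t := {malg scal[{fmonom (gen t)}]}.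

Definition sc t (c : scal) : symalg t := c%:MP.
Definition X t (eps : bool) (i : node t) (k : int) : symalg t :=
  << fmu (Xgen eps i k) >>.
Definition W t (i : node t) (m : nat) : symalg t := << fmu (Wgen i m) >>.
Definition W' t (i : node t) (m : nat) : symalg t := << fmu (Wgen' i m) >>.

Record is_tau t (tau : symalg t -> symalg t) : Prop := IsTau {
  tau_Qlinear : forall (q : rat) u v,
    tau ((ratr q : scal) *: u + v) = (ratr q : scal) *: tau u + tau v;
  tau_antimul : forall u v, tau (u * v) = tau v * tau u;
  tau_invol : involutive tau;
  tau_rh : tau (sc t rhS) = sc t shS;
  tau_sh : tau (sc t shS) = sc t rhS;
  tau_r : tau (sc t rS) = sc t sS;
  tau_s : tau (sc t sS) = sc t rS;
  tau_bracket : forall i j : node t,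
    tau (sc t (bracketS i j)) = sc t ((bracketS j i)^-1);
  tau_z : tau (sc t zS) = sc t (zS^-1);
  tau_X : forall eps i k, tau (X eps i k) = X (~~ eps) i (- k);
  tau_W : forall (i : node t) m, tau (W i m) = W' i m;
  tau_W' : forall (i : node t) m, tau (W' i m) = W i m
}.

(* A formal series sum_k f_k z^k, k in Z, is the family k |-> f_k. *)
Definition series t := int -> symalg t.

Definition delta_series t : series t := fun=> 1.
Definition x_series t (eps : bool) (i : node t) : series t :=
  fun k => X eps i (- k).
Definition w_series t (i : node t) : series t :=
  fun k => if (k <= 0)%R then W i `|k|%N else 0.
Definition w'_series t (i : node t) : series t :=
  fun k => if (0 <= k)%R then W' i `|k|%N else 0.

(* Since tau inverts z, the term of degree k of tau f is the image
   tau (f_{-k} z^{-k}) of the term of degree -k of f, and the coefficient of z^k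
   in tau f is this term times z^{-k}. *)
Definition tau_series t (tau : symalg t -> symalg t) (f : series t) : series t :=
  fun k => zS ^ (- k) *: tau (zS ^ (- k) *: f (- k)).

(* The field K(z). *)
Notation ratfun K := {fraction {poly K}}.
Definition cst (K : fieldType) (c : K) : ratfun K := (c%:P)%:F.
Definition zK (K : fieldType) : ratfun K := ('X : {poly K})%:F.

Definition gK (K : fieldType) (r s rh sh : K) t (eps : bool) (i j : node t)
    (w : ratfun K) : ratfun K :=
  g (cst r) (cst s) (cst rh) (cst sh) eps i j w.

Definition eval_poly (K : fieldType) (rh sh : K) (p : scal_poly) : ratfun K :=
  mpoly.mmap intr (fun k : 'I_3 => [:: cst rh; cst sh; zK K]`_k) p.

(* h in K(z) is the value of the symbolic scalar f once the symbols r^{1/2} and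
   s^{1/2} are given the values rh and sh.  Such an h is unique; it exists when f
   has an expression whose denominator does not vanish at (rh, sh). *)
Definition specializes (K : fieldType) (rh sh : K) (f : scal) (h : ratfun K) :=
  exists n d : scal_poly,
    [/\ eval_poly rh sh d != 0, f = n%:F / d%:F
      & h = eval_poly rh sh n / eval_poly rh sh d].

(* The hypotheses gathered in [is_tau] are satisfiable. *)
Module TauExistence.

Section FracExt.
Variables (P : idomainType) (E : fieldType) (phi : {rmorphism P -> E}).
Hypothesis phi_inj : forall p, phi p = 0 -> p = 0.

Lemma piE_frac (x : {ratio P}) :
  (\pi_({fraction P}))%qT x = (x.1)%:F / (x.2)%:F.
Proof.
rewrite /GRing.inv /GRing.mul /= !piE /FracField.invf /FracField.mulf.
by rewrite !numden_Ratio ?oner_neq0 ?denom_ratioP // ?mulf_neq0 ?oner_neq0 ?denom_ratioP // mulr1 mul1r Ratio_numden.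
Qed.

Lemma fracE (x : {fraction P}) : x = ((repr x).1)%:F / ((repr x).2)%:F.
Proof. by rewrite -piE_frac reprK. Qed.

Definition frac_ext (x : {fraction P}) : E := phi (repr x).1 / phi (repr x).2.

Lemma phi_neq0 p : p != 0 -> phi p != 0.
Proof. by move=> p0; apply/eqP => /phi_inj e; rewrite e eqxx in p0. Qed.

Lemma frac_extE n d : d != 0 -> frac_ext (n%:F / d%:F) = phi n / phi d.
Proof.
move=> d0; rewrite /frac_ext; set x : {fraction P} := n%:F / d%:F.
have d'0 : (repr x).2 != 0 by apply: denom_ratioP.
have := fracE x; rewrite {1}/x => /eqP.
rewrite eqr_div ?tofrac_eq0 // -!tofracM tofrac_eq => /eqP e.
by apply/eqP; rewrite eqr_div ?phi_neq0 // -!rmorphM e.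
Qed.

Lemma frac_ext_tofrac n : frac_ext n%:F = phi n.
Proof.
have := @frac_extE n 1 (oner_neq0 _).
by rewrite tofrac1 rmorph1 !divr1.
Qed.

Lemma frac_ext_zmod : zmod_morphism frac_ext.
Proof.
move=> x y; rewrite [x]fracE [y]fracE.
set a := (repr x).1; set b := (repr x).2; set c := (repr y).1; set d := (repr y).2.
have b0 : b != 0 by apply: denom_ratioP.
have d0 : d != 0 by apply: denom_ratioP.
rewrite -mulNr addf_div ?tofrac_eq0 // -tofracN -!tofracM -tofracD.
rewrite !frac_extE ?mulf_neq0 // -mulNr addf_div ?phi_neq0 //.
by rewrite !(rmorphM, rmorphD, rmorphN).
Qed.

Lemma frac_ext_monoid : monoid_morphism frac_ext.
Proof.
split=> [|x y]; first by rewrite -tofrac1 frac_ext_tofrac rmorph1.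
rewrite [x]fracE [y]fracE.
set a := (repr x).1; set b := (repr x).2; set c := (repr y).1; set d := (repr y).2.
have b0 : b != 0 by apply: denom_ratioP.
have d0 : d != 0 by apply: denom_ratioP.
rewrite mulf_div -!tofracM !frac_extE ?mulf_neq0 //.
by rewrite mulf_div !rmorphM.
Qed.
End FracExt.

Local Notation P := scal_poly.

Definition swp (k : 'I_3) : scal := [:: shS; rhS; zS^-1]`_k.
Definition phi : P -> scal := mpoly.mmap intr swp.
HB.instance Definition _ := GRing.RMorphism.copy phi (mpoly.mmap intr swp).

Lemma phiE (p : P) : phi p = \sum_(m <- mpoly.msupp p) (mpoly.mcoeff m p)%:~R * mpoly.mmap1 swp m.
Proof. by []. Qed.


Lemma mX_neq0 (m : mpoly.multinom 3) : mpoly.mpolyX int m != 0 :> P.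
Proof.
apply/eqP => /(congr1 (mpoly.mcoeff m)) /eqP.
by rewrite mpoly.mcoeffX eqxx mpoly.mcoeff0.
Qed.
Lemma zS_neq0 : zS != 0.
Proof. by rewrite /zS /scal_var tofrac_eq0 mX_neq0. Qed.

Lemma cstF c : (mpoly.mpolyC 3 c : P)%:F = c%:~R.
Proof. by rewrite -[c in LHS]intz !rmorph_int. Qed.

Lemma scal_varX (m : mpoly.multinom 3) : \prod_(i < 3) scal_var i ^+ m i = (mpoly.mpolyX int m : P)%:F.
Proof.
rewrite mpoly.mpolyXE_id rmorph_prod; apply: eq_bigr => i _.
by rewrite rmorphXn.
Qed.

Local Notation o k := (inord k : 'I_3).
Definition rev_mon N (m : mpoly.multinom 3) : mpoly.multinom 3 :=
  @mpoly.Multinom 3 [tuple of [:: m (o 1); m (o 0); N - m (o 2)]%N].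
Lemma o3 (F : 'I_3 -> scal) : \prod_(i < 3) F i = F (o 0) * F (o 1) * F (o 2).
Proof.
rewrite !big_ord_recr big_ord0 /= mul1r.
congr (F _ * F _ * F _); apply: val_inj; by rewrite /= inordK.
Qed.

Lemma rev_monE N (m : mpoly.multinom 3) : (m (o 2) <= N)%N ->
  zS ^+ N * mpoly.mmap1 swp m = (mpoly.mpolyX int (rev_mon N m) : P)%:F.
Proof.
move=> le; rewrite -scal_varX /mpoly.mmap1 !o3 /swp !inordK //=.
rewrite !mpoly.multinomE !(tnth_nth 0%N) !inordK //=.
rewrite -/rhS -/shS -/zS.
rewrite mulrCA; congr (_ * _); first by rewrite mulrC.
rewrite -{1}(subnK le) exprD exprVn -mulrA mulfV ?mulr1 //.
by rewrite expf_neq0 ?zS_neq0.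
Qed.


Lemma phi_inj p : phi p = 0 -> p = 0.
Proof.
move=> p0; set N := (\max_(m <- mpoly.msupp p) m (o 2))%N.
pose q : P := \sum_(m <- mpoly.msupp p) mpoly.mcoeff m p *: mpoly.mpolyX int (rev_mon N m).
have leN m : m \in mpoly.msupp p -> (m (o 2) <= N)%N.
  by move=> mp; exact: (@leq_bigmax_seq (mpoly.multinom 3) (mpoly.msupp p) xpredT (fun m : mpoly.multinom 3 => m (o 2)) m mp isT).
have qF : q%:F = zS ^+ N * phi p.
  rewrite phiE mulr_sumr rmorph_sum big_seq [RHS]big_seq /=; apply: eq_bigr => m mp.
  by rewrite mulrCA rev_monE ?leN // -mpoly.mul_mpolyC rmorphM [X in X * _ = _]cstF.
have q0 : q = 0 by apply/eqP; rewrite -tofrac_eq0 qF p0 mulr0.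
apply/mpoly.mpolyP => m; rewrite mpoly.mcoeff0; apply/eqP.
rewrite mpoly.mcoeff_eq0; apply/negP => mp.
have := congr1 (mpoly.mcoeff (rev_mon N m)) q0.
rewrite mpoly.mcoeff0 raddf_sum /= (bigD1_seq m) ?mpoly.msupp_uniq //=.
rewrite mpoly.mcoeffZ mpoly.mcoeffX eqxx mulr1 big1_seq => [|m' /andP[ne m'p]].
  by rewrite addr0 => /eqP; rewrite mpoly.mcoeff_eq0 mp.
rewrite mpoly.mcoeffZ mpoly.mcoeffX; case: eqP => [e|]; last by rewrite mulr0.
case/eqP: ne; apply/mpoly.mnmP => i.
have e0 := congr1 (fun x : mpoly.multinom 3 => x (o 0)) e.
have e1 := congr1 (fun x : mpoly.multinom 3 => x (o 1)) e.
have e2 := congr1 (fun x : mpoly.multinom 3 => x (o 2)) e.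
rewrite /= !mpoly.multinomE !(tnth_nth 0%N) !inordK //= in e0 e1 e2.
have {}e2 : m' (o 2) = m (o 2).
  by rewrite -(subKn (leN _ m'p)) e2 subKn // leN.
have -> : i = o i by rewrite inord_val.
by case: i => [[|[|[]]]].
Qed.

Definition theta : scal -> scal := frac_ext phi.
HB.instance Definition _ := GRing.isZmodMorphism.Build scal scal theta (frac_ext_zmod phi_inj).
HB.instance Definition _ := GRing.isMonoidMorphism.Build scal scal theta (frac_ext_monoid phi_inj).

Lemma thetaV k : theta (scal_var k) = swp k.
Proof.
rewrite /theta frac_ext_tofrac; last exact: phi_inj.
by rewrite -[LHS]/(mpoly.mmap intr swp (mpoly.mpolyX int (mpoly.mnm1 k))) mpoly.mmapX mpoly.mmap1U.
Qed.
Lemma theta_rh : theta rhS = shS. Proof. by rewrite thetaV /swp inordK. Qed.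
Lemma theta_sh : theta shS = rhS. Proof. by rewrite thetaV /swp inordK. Qed.
Lemma theta_z : theta zS = zS^-1. Proof. by rewrite thetaV /swp inordK. Qed.

Lemma theta_swp k : theta (swp k) = scal_var k.
Proof.
rewrite /swp; have -> : k = o k by rewrite inord_val.
case: k => [[|[|[|//]]]] lt /=; rewrite inordK //= ?theta_sh ?theta_rh //.
by rewrite fmorphV /= theta_z invrK.
Qed.

Lemma theta_phi p : theta (phi p) = p%:F.
Proof.
rewrite phiE [in RHS](mpoly.mpolyE p) !rmorph_sum; apply: eq_bigr => m _.
rewrite rmorphM rmorph_int -mpoly.mul_mpolyC rmorphM [X in _ = X * _]cstF.
congr (_ * _); apply: etrans (scal_varX m); rewrite /mpoly.mmap1 rmorph_prod.
by apply: eq_bigr => i _; rewrite rmorphXn /= theta_swp.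
Qed.

Lemma thetaK : involutive theta.
Proof.
have D (x y : scal) : theta (x / y) = theta x / theta y by exact: fmorph_div.
move=> x; have [n [d ->]] : exists n d : P, x = n%:F / d%:F :> scal by do 2 eexists; exact: fracE.
apply: etrans (congr1 theta (D n%:F d%:F)) _.
apply: etrans (D _ _) _.
have H p : theta p%:F = phi p by apply: frac_ext_tofrac; exact: phi_inj.
by rewrite !H !theta_phi.
Qed.


Lemma brexpV t (i j : node t) :
  (brexp j i).1 = - (brexp i j).2 /\ (brexp j i).2 = - (brexp i j).1.
Proof.
rewrite /brexp; case: (eqVneq i j) => [_|ne] /=; first by [].
case: (ltngtP (label i) (label j)) => /= ab; last first.
- by case/eqP: ne; apply/val_inj; case: ab.
all: case: (_ == (-1 : int)) => //.
all: move: (label i) (label j) ab; clear i j ne => a b; case: t => //= n.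
all: case: (eqVneq a n.-1) => [->|_]; case: (eqVneq b n.-1) => [->|_]; rewrite ?ltnn //=.
all: case: (eqVneq _ n) => [->|_]; rewrite ?ltnn ?andbF //=.
Qed.

Section Tau.
Variable t : dynkin.
Local Notation A := (symalg t).

Definition tgen (x : gen t) : gen t := match x with
  | Xgen e i k => Xgen (~~ e) i (- k) | Wgen i m => Wgen' i m | Wgen' i m => Wgen i m end.
Lemma tgenK : involutive tgen.
Proof. by case=> // e i k /=; rewrite negbK opprK. Qed.
Definition tmon (m : {fmonom (gen t)}) : {fmonom (gen t)} := FMonom (rev (map tgen m)).
Lemma tmonK : involutive tmon.
Proof. by case=> s; rewrite /tmon /= map_rev revK -map_comp map_id_in // => x _; exact: tgenK. Qed.

Definition ftau (c : scal) : A := (theta c)%:MP.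
HB.instance Definition _ := GRing.Additive.copy ftau (@malgC {fmonom (gen t)} scal \o theta).
Definition tau0 : A -> A := monalg.mmap ftau (fun m => << tmon m >>).
HB.instance Definition _ := GRing.Additive.copy tau0 (monalg.mmap ftau (fun m => << tmon m >>)).

Lemma tau0U c m : tau0 << c *g m >> = << theta c *g tmon m >>.
Proof.
by rewrite /tau0 mmapU /ftau mul_malgC; apply/malgP => k; rewrite mcoeffZ !mcoeffU mulrnAr mulr1.
Qed.
Lemma tau0_sum (I : Type) (r : seq I) (F : I -> A) : tau0 (\sum_(i <- r) F i) = \sum_(i <- r) tau0 (F i).
Proof. exact: raddf_sum. Qed.

Lemma UM (c d : scal) (m n : {fmonom (gen t)}) :
  << c *g m >> * << d *g n >> = << c * d *g mmul m n >> :> A.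
Proof. exact: fgmulUU. Qed.
Lemma tmonM m n : tmon (mmul m n) = mmul (tmon n) (tmon m).
Proof. by rewrite /mmul /= !fmmulE /tmon /= map_cat rev_cat. Qed.

Lemma ZU (c d : scal) (m : {fmonom (gen t)}) : c *: << d *g m >> = << c * d *g m >> :> A.
Proof. by apply/malgP => k; rewrite mcoeffZ !mcoeffU mulrnAr. Qed.
Lemma tau0Z c (u : A) : tau0 (c *: u) = theta c *: tau0 u.
Proof.
rewrite (monalgE u) scaler_sumr !tau0_sum scaler_sumr; apply: eq_bigr => m _.
by rewrite ZU !tau0U ZU rmorphM.
Qed.
Lemma tau0D (u v : A) : tau0 (u + v) = tau0 u + tau0 v.
Proof. exact: raddfD. Qed.
Lemma tau0M u v : tau0 (u * v) = tau0 v * tau0 u.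
Proof.
rewrite [in LHS](monalgE u) [in LHS](monalgE v) [in RHS](monalgE u) [in RHS](monalgE v).
rewrite mulr_suml !tau0_sum mulr_sumr /=; apply: eq_bigr => m _.
rewrite mulr_sumr mulr_suml tau0_sum /=; apply: eq_bigr => n _.
by rewrite UM !tau0U UM rmorphM mulrC tmonM.
Qed.

Lemma tau0K : involutive tau0.
Proof.
move=> u; rewrite [in LHS](monalgE u) [in RHS](monalgE u) !tau0_sum; apply: eq_bigr => m _ /=.
by rewrite !tau0U thetaK tmonK.
Qed.

Lemma tau0_sc c : tau0 (sc t c) = sc t (theta c).
Proof. by rewrite /sc tau0U; congr << _ *g _ >>; rewrite /mone /= fmoneE. Qed.

Lemma theta_bracket (i j : node t) : theta (bracketS i j) = (bracketS j i)^-1.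
Proof.
have nm : theta (bracketS i j) = mono sS rS (brexp i j).
  by rewrite /bracketS /bracket /mono rmorphM !fmorphXz /rS /sS !rmorphXn /= theta_rh theta_sh.
rewrite nm /bracketS /bracket /mono invfM !invr_expz mulrC.
by case: (brexpV i j) => -> ->; rewrite ?opprK.
Qed.

Lemma tau0P : is_tau tau0.
Proof.
split.
- by move=> q u v; rewrite tau0D tau0Z fmorph_rat.
- exact: tau0M.
- exact: tau0K.
- by rewrite tau0_sc theta_rh.
- by rewrite tau0_sc theta_sh.
- by rewrite tau0_sc rmorphXn /= theta_rh.
- by rewrite tau0_sc rmorphXn /= theta_sh.
- by move=> i j; rewrite tau0_sc theta_bracket.
- by rewrite tau0_sc theta_z.
- by move=> e i k; rewrite /X tau0U rmorph1; congr << _ *g _ >>; rewrite !fmuE.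
- by move=> i k; rewrite /W tau0U rmorph1; congr << _ *g _ >>; rewrite !fmuE.
- by move=> i k; rewrite /W' tau0U rmorph1; congr << _ *g _ >>; rewrite !fmuE.
Qed.
End Tau.

End TauExistence.

Lemma tau_exists t : exists tau : symalg t -> symalg t, is_tau tau.
Proof. by exists (@TauExistence.tau0 t); exact: TauExistence.tau0P. Qed.

(* Main.v *)
From HB Require Import structures.
Require Import Defs.
From mathcomp Require Import all_boot all_order all_algebra fraction.
From mathcomp Require Import monalg ring.

Set Implicit Arguments.
Unset Strict Implicit.
Unset Printing Implicit Defensive.

Import GRing.Theory.
Local Open Scope ring_scope.

(** Put [A = (<j,i> <i,j>^-1)^(1/2)] and [B = (<i,j> <j,i>)^(1/2)]. Then
    [<j,i> = A B], so [g_ij^+(w) = A B (w - B^-1) / (w - B)], a Moebius map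
    [moebius A B w]; the sign [-] replaces [(A, B)] by [(A^-1, B^-1)], exchanging
    [i] and [j] replaces it by [(A^-1, B)], and [tau] fixes [A] and inverts [B]
    and [z].  All identities of (i) are then symmetries of [moebius].
    Two maps compatible with sums, products and inverses that agree on
    [r^(1/2), s^(1/2), z] agree on all scalars, so there [tau] is the field
    automorphism [theta] given by [r^(1/2) <-> s^(1/2)], [z -> z^-1]. As scalars
    are central, [tau] is [theta]-semilinear, and (ii) follows termwise. *)

(** * Moebius maps and monomials in two variables *)

Section Moebius.
Variable E : fieldType.
Implicit Types A B w : E.

Definition moebius A B w : E := (A * B * w - A) / (w - B).

Lemma moebiusE A B w : B != 0 -> moebius A B w = A * B * (w - B^-1) / (w - B).
Proof. by move=> B0; rewrite /moebius mulrBr mulfK. Qed.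

(** Inversion exchanges the factors [w - B] and [w - B^-1] of [moebiusE]; with [0^-1 = 0] this
    covers the zero and the pole as well. *)
Lemma moebiusV A B w : A != 0 -> B != 0 ->
  (moebius A B w)^-1 = moebius A^-1 B^-1 w.
Proof.
by move=> A0 B0; rewrite !moebiusE ?invr_eq0 // invf_div !invfM invrK; ring.
Qed.

Lemma moebius_inv A B w : B != 0 -> w != 0 ->
  moebius A B w^-1 = moebius A B^-1 w.
Proof.
move=> B0 w0; rewrite !moebiusE ?invr_eq0 // invrK.
have -> : w^-1 - B^-1 = - (w - B) / (w * B) by field; rewrite w0 B0.
have -> : w^-1 - B = - (w - B^-1) * (B / w) by field; rewrite w0 B0.
rewrite !mulNr mulrN invrN mulrNN [X in _ * X]invfM.
(* Keeping this inverse opaque spares [field] the condition [w != B^-1]. *)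
set u := (w - B^-1)^-1.
by field; rewrite w0 B0.
Qed.

Lemma moebius_neq0 A B w : A != 0 -> B != 0 -> w != B -> w != B^-1 ->
  moebius A B w != 0.
Proof.
by move=> A0 B0 wB wV; rewrite moebiusE // !mulf_neq0 ?invr_eq0 ?subr_eq0.
Qed.

Variables rh sh : E.
Hypotheses (rh0 : rh != 0) (sh0 : sh != 0).

Lemma mono_neq0 e : mono rh sh e != 0.
Proof. by rewrite mulf_neq0 ?expfz_neq0. Qed.

Lemma monoD e f : mono rh sh (e + f) = mono rh sh e * mono rh sh f.
Proof. by rewrite /mono !expfzDr // mulrACA. Qed.

Lemma monoN e : mono rh sh (- e) = (mono rh sh e)^-1.
Proof. by rewrite /mono /= -!invr_expz invfM. Qed.

Lemma mono_sqr e : mono (rh ^+ 2) (sh ^+ 2) e = mono rh sh (e + e).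
Proof. by rewrite monoD /mono !expr2 !expfzMl mulrACA. Qed.
End Moebius.

(** * The functions g as Moebius maps, and their symmetries *)

Section BracketRoots.
Variable t : dynkin.
Implicit Types i j : node t.

(** This is [A] of the overview; [product_root] is [B]. *)
Definition ratio_root (E : fieldType) (rh sh : E) i j :=
  mono rh sh (brexp j i - brexp i j).
Definition product_root (E : fieldType) (rh sh : E) i j :=
  mono rh sh (brexp i j + brexp j i).

Section Field.
Variables (E : fieldType) (rh sh : E).
Hypotheses (rh0 : rh != 0) (sh0 : sh != 0).

Lemma ratio_rootC i j : ratio_root rh sh j i = (ratio_root rh sh i j)^-1.
Proof. by rewrite -monoN opprB. Qed.

Lemma product_rootC i j : product_root rh sh j i = product_root rh sh i j.
Proof. by rewrite /product_root addrC. Qed.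

(** The exponents of the two roots add up to twice [brexp j i], so their product is the bracket of
    [j] and [i]. *)
Lemma g_moebius eps i j w :
  g (rh ^+ 2) (sh ^+ 2) rh sh eps i j w =
  moebius (ratio_root rh sh i j ^ sgn eps) (product_root rh sh i j ^ sgn eps) w.
Proof.
rewrite /g /moebius -/(ratio_root rh sh i j) -/(product_root rh sh i j).
rewrite -expfzMl /bracket mono_sqr // /ratio_root /product_root -monoD //.
by rewrite addrA subrK.
Qed.

Lemma root_sgnN A eps : (A : E) ^ sgn (~~ eps) = (A ^ sgn eps)^-1.
Proof. by case: eps; rewrite /= ?expr1z ?exprN1 ?invrK. Qed.

Lemma gV eps i j w :
  (g (rh ^+ 2) (sh ^+ 2) rh sh eps i j w)^-1 =
  g (rh ^+ 2) (sh ^+ 2) rh sh (~~ eps) i j w.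
Proof.
by rewrite !g_moebius moebiusV ?expfz_neq0 ?mono_neq0 // !root_sgnN.
Qed.

(** Inverting [w] inverts only the product root. On the right the opposite sign inverts both roots,
    and exchanging [i] and [j] restores the ratio root. *)
Lemma g_inv eps i j w : w != 0 ->
  g (rh ^+ 2) (sh ^+ 2) rh sh eps i j w^-1 =
  g (rh ^+ 2) (sh ^+ 2) rh sh (~~ eps) j i w.
Proof.
move=> w0; rewrite !g_moebius moebius_inv ?expfz_neq0 ?mono_neq0 //.
by rewrite !root_sgnN ratio_rootC product_rootC exprz_inv -invr_expz.
Qed.

(** Numerator and denominator can vanish only at monomials in [rh] and [sh]. *)
Lemma g_neq0 eps i j w : (forall e, w != mono rh sh e) ->
  g (rh ^+ 2) (sh ^+ 2) rh sh eps i j w != 0.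
Proof.
move=> wB; have wP b : w != product_root rh sh i j ^ sgn b.
  by case: b; rewrite /= ?expr1z ?exprN1 -?monoN; apply: wB.
by rewrite g_moebius moebius_neq0 ?expfz_neq0 ?mono_neq0 -?root_sgnN.
Qed.
End Field.

Section Swap.
Variables (E : fieldType) (rh sh : E).
Hypotheses (rh0 : rh != 0) (sh0 : sh != 0).

(** By [brexpV], exchanging r and s sends <i,j> to <j,i>^-1. This fixes <j,i><i,j>^-1 and inverts
    <i,j><j,i>. *)
Lemma ratio_root_swap i j : ratio_root sh rh i j = ratio_root rh sh i j.
Proof.
rewrite /ratio_root /mono /=; have [-> ->] := TauExistence.brexpV i j.
by rewrite mulrC [- (brexp i j).1 - _]addrC.
Qed.

Lemma product_root_swap i j : product_root sh rh i j = (product_root rh sh i j)^-1.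
Proof.
rewrite -monoN // /product_root /mono /=; have [-> ->] := TauExistence.brexpV i j.
by rewrite mulrC !opprB.
Qed.

(** The swap and the inversion of [w] each invert the product root, so they cancel. *)
Lemma g_swap eps i j w : w != 0 ->
  g (sh ^+ 2) (rh ^+ 2) sh rh eps i j w^-1 =
  g (rh ^+ 2) (sh ^+ 2) rh sh eps i j w.
Proof.
move=> w0; rewrite !g_moebius // moebius_inv ?expfz_neq0 ?mono_neq0 //.
by rewrite ratio_root_swap product_root_swap exprz_inv -invr_expz invrK.
Qed.
End Swap.

Lemma rmorph_g (E F : fieldType) (f : {rmorphism E -> F}) r s rh sh eps i j w :
  f (g r s rh sh eps i j w) =
  g (f r) (f s) (f rh) (f sh) eps i j (f w).
Proof.
rewrite /g /bracket /mono fmorph_div !rmorphB !(rmorphM, fmorphXz).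
by [].
Qed.

Lemma g_fixed (E : fieldType) (theta : {rmorphism E -> E}) (rh sh z : E)
  eps i j :
  rh != 0 -> sh != 0 -> z != 0 ->
  theta rh = sh -> theta sh = rh -> theta z = z^-1 ->
  theta (g (rh ^+ 2) (sh ^+ 2) rh sh eps i j z) =
  g (rh ^+ 2) (sh ^+ 2) rh sh eps i j z.
Proof.
move=> rh0 sh0 z0 t_rh t_sh t_z.
by rewrite rmorph_g !rmorphXn /= t_rh t_sh t_z g_swap.
Qed.
End BracketRoots.

Lemma scal_var_neq0 k : scal_var k != 0.
Proof. by rewrite /scal_var tofrac_eq0 TauExistence.mX_neq0. Qed.

(** * Anti-multiplicative involutions restricted to central scalars *)

Section ScalarAutomorphism.
Variables (S : fieldType) (A : pzRingType) (iota : {rmorphism S -> A}).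
Variables (theta : {rmorphism S -> S}) (tau : A -> A).
Hypotheses (tauD : {morph tau : u v / u + v}).
Hypotheses (tauM : forall u v, tau (u * v) = tau v * tau u).
Hypotheses (tauK : involutive tau).

Lemma antimorph0 : tau 0 = 0.
Proof. by apply: (addIr (tau 0)); rewrite -tauD !add0r. Qed.

Lemma antimorphN : {morph tau : u / - u}.
Proof. by move=> u; apply: (addIr (tau u)); rewrite -tauD !addNr antimorph0. Qed.

(** Since [1 = tau (tau 1)] lies in the image of [tau], it can be absorbed by
    anti-multiplicativity. *)
Lemma antimorph1 : tau 1 = 1.
Proof. by rewrite -[LHS]mulr1 -[X in _ * X]tauK -tauM mulr1 tauK. Qed.

(** The scalars with this property are shown to form a subfield, so agreement need only be checked
    on generators. *)
Definition acts_as c := tau (iota c) = iota (theta c).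

Lemma acts_as0 : acts_as 0.
Proof. by rewrite /acts_as !rmorph0 antimorph0. Qed.

Lemma acts_as1 : acts_as 1.
Proof. by rewrite /acts_as !rmorph1 antimorph1. Qed.

Lemma acts_asD c d : acts_as c -> acts_as d -> acts_as (c + d).
Proof. by move=> tc td; rewrite /acts_as !rmorphD tauD tc td. Qed.

Lemma acts_asN c : acts_as c -> acts_as (- c).
Proof. by move=> tc; rewrite /acts_as !rmorphN antimorphN tc. Qed.

Lemma acts_asM c d : acts_as c -> acts_as d -> acts_as (c * d).
Proof. by move=> tc td; rewrite /acts_as [in LHS]mulrC !rmorphM tauM tc td. Qed.

(** The element [tau (iota c^-1)] is a left inverse of [iota (theta c)], hence equals its known
    right inverse; this works in a noncommutative [A]. *)
Lemma acts_asV c : acts_as c -> acts_as c^-1.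
Proof.
have [->|c0] := eqVneq c 0; first by rewrite invr0.
move=> tc; have inv1 : tau (iota c^-1) * iota (theta c) = 1.
  by rewrite -tc -tauM -rmorphM mulfV // rmorph1 antimorph1.
have inv2 : iota (theta c) * iota (theta c)^-1 = 1.
  by rewrite -rmorphM mulfV ?fmorph_eq0 // rmorph1.
by rewrite /acts_as fmorphV -[LHS]mulr1 -inv2 mulrA inv1 mul1r.
Qed.

Lemma acts_asX c n : acts_as c -> acts_as (c ^+ n).
Proof.
move=> tc; elim: n => [|n IH]; first exact: acts_as1.
by rewrite exprS; exact: acts_asM.
Qed.

Lemma acts_as_int (n : int) : acts_as n%:~R.
Proof.
have nat_case m : acts_as m%:R.
  elim: m => [|m IH]; first exact: acts_as0.
  by rewrite mulrS; apply: acts_asD => //; exact: acts_as1.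
by case: n => m; [exact: nat_case | rewrite NegzE mulrNz; exact/acts_asN/nat_case].
Qed.
End ScalarAutomorphism.

(** A constant is supported at the unit monomial, which is neutral on both sides. *)
Lemma malgC_central (M : monomType) (S : comNzRingType) (c : S)
  (u : {malg S[M]}) : u * c%:MP = c *: u.
Proof.
rewrite -mul_malgC [u]monalgE mulr_suml mulr_sumr; apply: eq_bigr => m _.
apply: etrans (fgmulUU _ _ _ _) (etrans _ (esym (fgmulUU _ _ _ _))).
by rewrite mulrC mulm1 mul1m.
Qed.

(** Anti-multiplicativity moves the scalar to the right; centrality brings it back. *)
Lemma antimorphZ (M : monomType) (S : comNzRingType) (theta : S -> S)
  (tau : {malg S[M]} -> {malg S[M]})
  (tauM : forall u v, tau (u * v) = tau v * tau u)
  (tauC : forall c : S, tau c%:MP = (theta c)%:MP) c u :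
  tau (c *: u) = theta c *: tau u.
Proof. by rewrite -mul_malgC tauM tauC malgC_central. Qed.

(** * Semilinearity of [tau] and its action on series *)

Section TauScalars.
Variables (t : dynkin) (tau : symalg t -> symalg t).
Hypothesis tauP : is_tau tau.
Variable theta : {rmorphism scal -> scal}.
Hypotheses (theta_rh : theta rhS = shS) (theta_sh : theta shS = rhS).
Hypothesis theta_z : theta zS = zS^-1.

(** Additivity is rational linearity with coefficient 1. *)
Lemma tauD : {morph tau : u v / u + v}.
Proof. by move=> u v; have := tau_Qlinear tauP 1%:R u v; rewrite ratr_nat !scale1r. Qed.

Local Notation iota := (@malgC {fmonom (gen t)} scal).
Local Notation tau_theta := (acts_as iota theta tau).

Lemma tau_theta_var k : tau_theta (scal_var k).
Proof.
rewrite -[k]inord_val /acts_as; case: k => [[|[|[|//]]]] lt /=.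
- by rewrite theta_rh (tau_rh tauP).
- by rewrite theta_sh (tau_sh tauP).
- by rewrite theta_z (tau_z tauP).
Qed.

(** Agreement on the three variables spreads to monomials, then to integer polynomials, then to
    their fractions. *)
Lemma tau_sc c : tau (sc t c) = sc t (theta c).
Proof.
rewrite -/(tau_theta c).
have tauM := tau_antimul tauP; have tauK := tau_invol tauP.
have tau1 : tau_theta 1 by exact: acts_as1.
have poly_case (p : scal_poly) : tau_theta p%:F.
  rewrite (mpoly.mpolyE p) rmorph_sum.
  apply: (big_ind tau_theta) => [|x y|m _].
  - exact: (acts_as0 _ _ tauD).
  - exact: (acts_asD tauD).
  rewrite -mpoly.mul_mpolyC rmorphM [X in X * _]TauExistence.cstF.
  apply: (acts_asM tauM); first exact: (acts_as_int _ _ tauD).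
  apply: (eq_ind _ tau_theta _ _ (TauExistence.scal_varX m)).
  apply: (big_ind tau_theta) => [|x y|k _]; [exact: tau1 | exact: (acts_asM tauM) |].
  exact/acts_asX/tau_theta_var.
have [n [d ->]] : exists n d : scal_poly, c = n%:F / d%:F :> scal.
  by do 2 eexists; exact: TauExistence.fracE.
exact: (acts_asM tauM (poly_case n) (acts_asV tauM tauK (poly_case d))).
Qed.

Lemma tauZ c u : tau (c *: u) = theta c *: tau u.
Proof. exact: (antimorphZ (tau_antimul tauP) tau_sc). Qed.

(** The inner power of z leaves [tau] inverted and cancels the outer one. *)
Lemma tau_seriesE f k : tau_series tau f k = tau (f (- k)).
Proof.
rewrite /tau_series tauZ scalerA fmorphXz /= theta_z exprz_inv opprK.
by rewrite -expfzDr ?scal_var_neq0 // addNr scale1r.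
Qed.

Lemma theta_gS eps (i j : node t) : theta (gS eps i j) = gS eps i j.
Proof.
exact: g_fixed (scal_var_neq0 _) (scal_var_neq0 _) (scal_var_neq0 _) _ _ _.
Qed.
End TauScalars.

(** * Specialization of fractions along a ring morphism *)

Section FractionSpecialization.
Variables (P : idomainType) (E L : fieldType).
Variables (iota : {rmorphism P -> E}) (ev : {rmorphism P -> L}).
Hypothesis iota_inj : injective iota.

(** This is [specializes] with the embedding and the evaluation kept abstract. *)
Definition specializes_via f h :=
  exists n d : P, [/\ ev d != 0, f = iota n / iota d & h = ev n / ev d].
Local Notation spec := specializes_via.

Lemma specialization_den d : ev d != 0 -> iota d != 0.
Proof.
apply: contraNneq => d0; have -> : d = 0 by apply: iota_inj; rewrite rmorph0.
by rewrite rmorph0.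
Qed.

Lemma specializes_iota p : spec (iota p) (ev p).
Proof. by exists p, 1; rewrite !rmorph1 !divr1 oner_neq0. Qed.

Lemma specializesB f f' h h' : spec f h -> spec f' h' -> spec (f - f') (h - h').
Proof.
move=> [n [d [d0 -> ->]]] [n' [d' [d'0 -> ->]]].
exists (n * d' - n' * d), (d * d'); split; first by rewrite rmorphM mulf_neq0.
- by rewrite -mulNr addf_div ?specialization_den // mulNr !(rmorphM, rmorphB).
- by rewrite -mulNr addf_div // mulNr !(rmorphM, rmorphB).
Qed.

Lemma specializesM f f' h h' : spec f h -> spec f' h' -> spec (f * f') (h * h').
Proof.
move=> [n [d [d0 -> ->]]] [n' [d' [d'0 -> ->]]].
exists (n * n'), (d * d'); split; first by rewrite rmorphM mulf_neq0.
- by rewrite mulf_div !rmorphM.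
- by rewrite mulf_div !rmorphM.
Qed.

(** As [h] is nonzero, so is the evaluated numerator, which can thus serve as denominator. *)
Lemma specializesV f h : h != 0 -> spec f h -> spec f^-1 h^-1.
Proof.
move=> h0 [n [d [d0 -> hE]]]; exists d, n; split.
- by apply: contraNneq h0 => n0; rewrite hE n0 mul0r.
- by rewrite invf_div.
- by rewrite hE invf_div.
Qed.

Lemma specializesXz f h (n : int) : h != 0 -> spec f h -> spec (f ^ n) (h ^ n).
Proof.
move=> h0 fh; have pow m : spec (f ^+ m) (h ^+ m).
  elim: m => [|m IH]; last by rewrite !exprS; exact: specializesM.
  by have := specializes_iota 1; rewrite !rmorph1.
case: n => m; first exact: pow.
by rewrite !NegzE -!invr_expz; apply: specializesV (pow _); rewrite expf_neq0.
Qed.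

Lemma specializes_mono f f' h h' e : h != 0 -> h' != 0 -> spec f h -> spec f' h' ->
  spec (mono f f' e) (mono h h' e).
Proof. by move=> h0 h'0 fh fh'; apply: specializesM; exact: specializesXz. Qed.

Lemma specializes_via_g t eps (i j : node t) rh sh z rh' sh' z' :
  rh' != 0 -> sh' != 0 -> (forall e, z' != mono rh' sh' e) ->
  spec rh rh' -> spec sh sh' -> spec z z' ->
  spec (g (rh ^+ 2) (sh ^+ 2) rh sh eps i j z)
       (g (rh' ^+ 2) (sh' ^+ 2) rh' sh' eps i j z').
Proof.
move=> rh0 sh0 z_mono s_rh s_sh s_z.
have s_root e : spec (mono rh sh e ^ sgn eps) (mono rh' sh' e ^ sgn eps).
  by apply: specializesXz; [exact: mono_neq0 | exact: specializes_mono].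
apply: specializesM.
  apply: specializesB (s_root _); apply: specializesM s_z.
  apply: specializesXz; first by rewrite mono_neq0 ?expf_neq0.
  by apply: specializes_mono; rewrite ?expf_neq0 //; exact: specializesM.
apply: specializesV; last exact: specializesB s_z (s_root _).
(* For either sign the root in the denominator is a monomial, which [z'] avoids. *)
rewrite subr_eq0; case: eps {s_root}; rewrite /= ?expr1z ?exprN1 -?monoN //;
  exact: z_mono.
Qed.
End FractionSpecialization.

HB.instance Definition _ (K : fieldType) :=
  GRing.RMorphism.copy (@cst K) (@FracField.tofrac {poly K} \o polyC).

(** * Evaluation of the symbols in K(z) *)

Section Specialization.
Variables (K : fieldType) (rh sh : K).
Local Notation ev := (eval_poly rh sh).

Lemma eval_poly_zmod : zmod_morphism ev.
Proof. by move=> p q; rewrite /eval_poly mpoly.mmapB. Qed.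

Lemma eval_poly_monoid : monoid_morphism ev.
Proof.
by have [MM M1] := @mpoly.mmap_is_multiplicative 3 int (ratfun K)
  (fun k : 'I_3 => [:: cst rh; cst sh; zK K]`_k) intr.
Qed.

HB.instance Definition _ :=
  GRing.isZmodMorphism.Build scal_poly (ratfun K) ev eval_poly_zmod.
HB.instance Definition _ :=
  GRing.isMonoidMorphism.Build scal_poly (ratfun K) ev eval_poly_monoid.

Local Notation spec := (specializes_via (@FracField.tofrac scal_poly) ev).

Lemma tofrac_inj : injective (@FracField.tofrac scal_poly).
Proof. by move=> p q /eqP; rewrite tofrac_eq => /eqP. Qed.

Lemma specializes_var k : spec (scal_var k) [:: cst rh; cst sh; zK K]`_k.
Proof.
have <- : ev (mpoly.mpolyX int (mpoly.mnm1 k)) = [:: cst rh; cst sh; zK K]`_k.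
  exact: etrans (mpoly.mmapX _ _ _) (mpoly.mmap1U _ _).
exact: specializes_iota.
Qed.

Hypotheses (rh0 : rh != 0) (sh0 : sh != 0).

Lemma cst_neq0 (c : K) : c != 0 -> cst c != 0.
Proof. by rewrite tofrac_eq0 polyC_eq0. Qed.

Lemma mono_cst e : mono (cst rh) (cst sh) e = cst (mono rh sh e).
Proof. by rewrite /mono rmorphM !fmorphXz. Qed.

Lemma cst_sqr (c : K) : cst (c ^+ 2) = cst c ^+ 2.
Proof. by rewrite rmorphXn. Qed.

(** The polynomial ['X] has size 2, a constant at most 1. *)
Lemma zK_neq_cst (c : K) : zK K != cst c.
Proof.
rewrite tofrac_eq; apply/eqP => /(congr1 (fun p : {poly K} => size p)).
by rewrite size_polyX size_polyC; case: (c != 0).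
Qed.

Lemma zK_neq_mono e : zK K != mono (cst rh) (cst sh) e.
Proof. by rewrite mono_cst zK_neq_cst. Qed.

Lemma specializes_g t eps (i j : node t) :
  specializes rh sh (gS eps i j) (gK (rh ^+ 2) (sh ^+ 2) rh sh eps i j (zK K)).
Proof.
have s_rh := specializes_var (inord 0); rewrite inordK // in s_rh.
have s_sh := specializes_var (inord 1); rewrite inordK // in s_sh.
have s_z := specializes_var (inord 2); rewrite inordK // in s_z.
rewrite /gK !cst_sqr.
exact: (specializes_via_g tofrac_inj eps i j (cst_neq0 rh0) (cst_neq0 sh0)
  zK_neq_mono s_rh s_sh s_z).
Qed.
End Specialization.

Import (canonicals) TauExistence.

(* An existential hides the definition of [theta], which unification would
   otherwise unfold down to representatives of fractions. *)
Lemma scalar_swap : exists theta : {rmorphism scal -> scal},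
  [/\ theta rhS = shS, theta shS = rhS & theta zS = zS^-1].
Proof.
exists TauExistence.theta; split.
- exact: TauExistence.theta_rh.
- exact: TauExistence.theta_sh.
- exact: TauExistence.theta_z.
Qed.

Unset Implicit Arguments.

Theorem proposition3p1
    (t : dynkin) (t_adm : admissible t)
    (K : closedFieldType) (K_char0 : [pchar K] =i pred0)
    (r s rh sh : K) (rhE : rh ^+ 2 = r) (shE : sh ^+ 2 = s)
    (r_neq0 : r != 0) (s_neq0 : s != 0) (rs_neq : r ^+ 2 != s ^+ 2)
    (tau : symalg t -> symalg t) (tauP : is_tau tau) :
  (forall (eps : bool) (i j : node t),
     [/\ tau (sc t (gS eps i j)) = sc t (gS eps i j)
           /\ specializes rh sh (gS eps i j) (gK r s rh sh eps i j (zK K)),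
         gK r s rh sh eps i j (zK K) != 0
           /\ (gK r s rh sh eps i j (zK K))^-1
              = gK r s rh sh (~~ eps) i j (zK K),
         gK r s rh sh eps i j ((zK K)^-1) = gK r s rh sh (~~ eps) j i (zK K)
       & gK r s rh sh (~~ eps) j i (zK K)
           = (gK r s rh sh eps j i (zK K))^-1])
  /\
  [/\ tau_series tau (@delta_series t) =1 @delta_series t,
      forall (eps : bool) (i : node t),
        tau_series tau (x_series eps i) =1 x_series (~~ eps) i,
      forall i : node t, tau_series tau (w_series i) =1 w'_series i
    & forall i : node t, tau_series tau (w'_series i) =1 w_series i].
Proof.
have [theta [theta_rh theta_sh theta_z]] := scalar_swap.
have tauE f k : tau_series tau f k = tau (f (- k)).
  exact: (tau_seriesE tauP theta_rh theta_sh theta_z).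
have rh0 : rh != 0 by apply: contraNneq r_neq0 => rh0; rewrite -rhE rh0 expr0n.
have sh0 : sh != 0 by apply: contraNneq s_neq0 => sh0; rewrite -shE sh0 expr0n.
rewrite -{}rhE -{}shE; split=> [eps i j|].
  have crh0 := cst_neq0 rh0; have csh0 := cst_neq0 sh0.
  (* Zero is read as the constant [cst 0]. *)
  have zK0 : zK K != 0 by rewrite -[0](rmorph0 (@cst K)) zK_neq_cst.
  have zK_mono := zK_neq_mono rh sh.
  rewrite /gK !cst_sqr; split; [split | split | |].
  - by rewrite (tau_sc tauP theta_rh theta_sh theta_z) theta_gS.
  - by have := specializes_g rh0 sh0 eps i j; rewrite /gK !cst_sqr.
  - exact: (g_neq0 crh0 csh0 eps i j zK_mono).
  - exact: (gV crh0 csh0 eps i j (zK K)).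
  - exact: (g_inv crh0 csh0 eps i j zK0).
  - exact: esym (gV crh0 csh0 eps j i (zK K)).
split=> [k|eps i k|i k|i k]; rewrite tauE.
- exact: antimorph1 (tau_antimul tauP) (tau_invol tauP).
- by rewrite /x_series opprK (tau_X tauP).
(* Passing to degree [- k] turns one support condition into the other; outside the support
   [tau 0 = 0] is needed. *)
- rewrite /w_series /w'_series Num.Theory.oppr_le0 abszN; case: ifP => _; first exact: tau_W.
  exact: antimorph0 (tauD tauP).
- rewrite /w_series /w'_series Num.Theory.oppr_ge0 abszN; case: ifP => _; first exact: tau_W'.
  exact: antimorph0 (tauD tauP).
Qed.
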